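(* Let $d\ge1$, $\sigma>0$, and let $A_0,A_1\in\mathbb{R}^{d\times d}$ be constant matrices. Let $G:[0,\infty)\to\mathbb{R}^{d\times d}$ be continuous with $A_1G(\vartheta)=G(\vartheta)A_1$ for all $\vartheta\ge0$, and let $\Psi:[-\sigma,0]\to\mathbb{R}^{d\times d}$ be differentiable with $A_1\Psi(\vartheta)=\Psi(\vartheta)A_1$ for all $\vartheta\in[-\sigma,0]$. Let $G^*(\vartheta)=G(0)$ for $\vartheta\in[-\sigma,0)$ and $G^*(\vartheta)=G(\vartheta)$ for $\vartheta\ge0$, and let $Z$ be the function defined in the context. Then the solution of \[ \dot X(\vartheta)=A_0X(\vartheta-\sigma)+X(\vartheta-\sigma)A_1+G(\vartheta),\ \ \vartheta\ge0,\qquad X(\vartheta)=\Psi(\vartheta),\ \ \vartheta\in[-\sigma,0], \] is given by \[ X(\vartheta)=Z(\vartheta)\Psi(-\sigma)+\int_{-\sigma}^{0}Z(\vartheta-\sigma-s)\dot\Psi(s)\,ds+\int_0^{\vartheta}Z(\vartheta-\sigma-s)G^*(s)\,ds,\qquad\vartheta\in[-\sigma,\infty). \]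
   Context: $\Theta$ and $I$ denote the $d\times d$ zero and identity matrices. Define matrices $Q_{r+1}(r\sigma)$, $r=0,1,2,\dots$, recursively by $Q_1(0)=I$ and $Q_{r+1}(r\sigma)=A_0Q_r((r-1)\sigma)+Q_r((r-1)\sigma)A_1$ for $r\ge 1$. Define $Z:\mathbb{R}\to\mathbb{R}^{d\times d}$ by $Z(\vartheta)=\Theta$ for $\vartheta<-\sigma$, and, for each integer $u\ge 0$ and $\vartheta\in[(u-1)\sigma,u\sigma)$, \[ Z(\vartheta)=\sum_{r=0}^{u}Q_{r+1}(r\sigma)\frac{(\vartheta-(r-1)\sigma)^r}{r!}. \]
   Formalization: The formal theorem additionally assumes that the entries of Ψ̇ are Lebesgue integrable on [-σ,0]; for a merely differentiable Ψ the integral of Z(ϑ-σ-s)Ψ̇(s) in the formula (e.g. at ϑ=0) may fail to exist. *)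

(* Defs.v *)
From HB Require Import structures.
From mathcomp Require Import all_boot all_order all_algebra.
From mathcomp Require Import all_classical all_reals all_analysis.
Set Implicit Arguments. Unset Strict Implicit. Unset Printing Implicit Defensive.
Import Order.TTheory GRing.Theory Num.Theory numFieldNormedType.Exports.
Local Open Scope classical_set_scope.
Local Open Scope ring_scope.

Section Defs.
Variables (R : realType) (d : nat) (sigma : R) (A0 A1 : 'M[R]_d).

(* Q r  stands for  Q_{r+1}(r sigma) *)
Fixpoint Qmat (r : nat) : 'M[R]_d :=
  match r with
  | 0%N => 1%:M
  | r'.+1 => A0 *m Qmat r' + Qmat r' *m A1
  end.

(* For theta >= -sigma, the unique u in nat with theta in [(u-1)sigma, u sigma). *)
Definition Zidx (theta : R) : nat := Num.truncn (theta / sigma + 1).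

Definition Zfun (theta : R) : 'M[R]_d :=
  if theta < - sigma then 0
  else \sum_(r < (Zidx theta).+1)
         ((theta - (r%:R - 1) * sigma) ^+ r / (r `!)%:R) *: Qmat r.

Definition oint (a b : R) (f : R -> R) : R :=
  if a <= b then Rintegral lebesgue_measure `[a, b] f
  else - Rintegral lebesgue_measure `[b, a] f.

Definition mxoint (a b : R) (F : R -> 'M[R]_d) : 'M[R]_d :=
  \matrix_(i, j) oint a b (fun s => F s i j).

Definition Gstar (G : R -> 'M[R]_d) (theta : R) : 'M[R]_d :=
  if theta < 0 then G 0 else G theta.

Definition rhs (G X : R -> 'M[R]_d) (theta : R) : 'M[R]_d :=
  A0 *m X (theta - sigma) + X (theta - sigma) *m A1 + G theta.

Definition is_solution (G Psi X : R -> 'M[R]_d) : Prop :=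
  (forall t, - sigma <= t <= 0 -> X t = Psi t) /\
  ((fun h : R => h^-1 *: (X h - X 0)) @ (0 : R)^'+ --> rhs G X 0) /\
  (forall t : R, 0 < t -> is_derive t (1 : R) X (rhs G X t)).

Definition Xformula (G Psi dPsi : R -> 'M[R]_d) (theta : R) : 'M[R]_d :=
  Zfun theta *m Psi (- sigma)
  + mxoint (- sigma) 0 (fun s => Zfun (theta - sigma - s) *m dPsi s)
  + mxoint 0 theta (fun s => Zfun (theta - sigma - s) *m Gstar G s).

End Defs.

(* Main.v *)
Require Import Defs.
From HB Require Import structures.
From mathcomp Require Import all_boot all_order all_algebra.
From mathcomp Require Import all_classical all_reals all_analysis.
From mathcomp Require Import measurable_realfun ring lra.
Import Order.TTheory GRing.Theory Num.Theory numFieldNormedType.Exports.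
Local Open Scope classical_set_scope.
Local Open Scope ring_scope.

(** Write [a = - sigma] and let [F] be [dPsi] on [[a, 0]] and [G] afterwards.
    Expanding [Z] in truncated powers [tpow r x = x_+^r / r!], the formula reads
    [X t = \sum_r Q_r W_r (t - r sigma)], where
    [W_r x = tpow r (x - a) Psi(a) + \int_a^x tpow r (x - s) F(s) ds].
    By dominated convergence [W_{r+1}' = W_r], away from a kink at [x = a] when
    [r = 0], which is only met from the right, at [t = 0].  Since [A1] commutes
    with every [W_r], [Q_{r+1} W_r = A0 Q_r W_r + Q_r W_r A1], so differentiating
    the sum termwise gives the equation.  On [[a, 0]] only [W_0] survives, and
    [W_0 = Psi] says that the merely integrable derivative [dPsi] integrates back
    to [Psi].  This is proved by comparing [Psi] with the primitive of a majorant
    of [dPsi] built from open neighbourhoods of the level sets of [dPsi].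
    Uniqueness is the method of steps. *)

Local Notation mu := lebesgue_measure.

(** * Integrating an everywhere-defined derivative *)

Lemma le_increment_of_local_right (R : realType) (f v : R -> R) (a b : R) :
  a < b -> {within `[a, b], continuous f} ->
  (forall x y, a <= x -> x <= y -> y <= b -> v x <= v y) ->
  (forall x, a < x < b -> \forall t \near x^'+, f t - f x <= v t - v x) ->
  f b - f a <= v b - v a.
Proof.
move=> ab cf vnd loc.
have {}cf x : a <= x <= b -> forall e, 0 < e -> exists2 d, 0 < d &
    forall y, a <= y <= b -> `|x - y| < d -> `|f x - f y| < e.
  move=> xab e e0.
  move/subspace_continuousP : cf => /(_ x); rewrite /= in_itv => /(_ xab).
  move=> /cvgrPdist_lt/(_ _ e0); rewrite /prop_near1 nbhs_simpl /=.
  rewrite /within /= => /nbhs_ballP[d/= d0 H]; exists d => // y yab xyd.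
  by apply: H => //=; rewrite in_itv.
have key a' : a < a' < b -> f b - f a' <= v b - v a'.
  move=> /andP[aa' a'b].
  pose S := [set x | a' <= x <= b /\ f x - f a' <= v x - v a'].
  have Sa' : S a' by split; rewrite ?lexx ?(ltW a'b)// !subrr.
  have ubS : ubound S b by move=> x [/andP[]].
  have hS : has_sup S by split; [exists a'|exists b].
  have a'c : a' <= sup S by apply: sup_upper_bound.
  have cb : sup S <= b by apply: ge_sup => //; exists a'.
  have Sc : S (sup S).
    split; first by rewrite a'c.
    rewrite leNgt; apply/negP => hc.
    have [d d0 Hd] := cf (sup S) (introT andP (conj (le_trans (ltW aa') a'c) cb))
      (f (sup S) - f a' - (v (sup S) - v a')) ltac:(by rewrite subr_gt0).
    have [x [/andP[a'x xb] Sx] xc] := sup_adherent d0 hS.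
    have xs : x <= sup S by apply: sup_upper_bound => //; split => //; rewrite a'x.
    have := Hd x; rewrite (le_trans (ltW aa') a'x) xb.
    move=> /(_ isT); rewrite ger0_norm ?subr_ge0// ltrBlDl -ltrBlDr xc => /(_ isT).
    rewrite ltr_norml => /andP[_].
    have := vnd x (sup S) (le_trans (ltW aa') a'x) xs cb.
    lra.
  move: cb; rewrite le_eqVlt => /orP[/eqP cb|cb]; first by rewrite -cb; case: Sc.
  have ac : a < sup S by exact: lt_le_trans a'c.
  have := loc (sup S); rewrite ac cb => /(_ isT) nr.
  have : \forall t \near (sup S)^'+, False; last first.
    by move=> /filter_ex[].
  near=> t.
  have ct : sup S < t by near: t; exact: nbhs_right_gt.
  have tb : t < b by near: t; exact: nbhs_right_lt.
  have : t <= sup S; last by rewrite leNgt ct.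
  apply: sup_upper_bound => //; split; first by rewrite (le_trans a'c (ltW ct)) ltW.
  have : f t - f (sup S) <= v t - v (sup S) by near: t.
  case: Sc; lra.
apply/ler_addgt0Pr => e e0.
have [d d0 Hd] := cf a (introT andP (conj (lexx a) (ltW ab))) e e0.
near a^'+ => a'.
have aa' : a < a' by near: a'; exact: nbhs_right_gt.
have a'b : a' < b by near: a'; exact: nbhs_right_lt.
have a'd : a' < a + d by near: a'; apply: nbhs_right_lt; rewrite ltrDl.
have := Hd a'; rewrite ltW// ltW// => /(_ isT).
rewrite ltr0_norm ?subr_lt0// opprB ltrBlDl => /(_ a'd).
rewrite ltr_norml => /andP[h1 h2].
have := key a'; rewrite aa' a'b => /(_ isT).
have := vnd a a' (lexx _) (ltW aa') (ltW a'b).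
lra.
Unshelve. all: by end_near. Qed.

(* [v x] is the mass of [[a, x]] for the density [\sum_k (k + 1) eps 1_{U k}],
   where [U k] is an open set slightly larger than the level set
   [E k = {k eps <= psi < (k + 1) eps}]: being open, [U k] contributes slope
   [(k + 1) eps > psi x] at every [x] of [E k]. *)
Lemma exists_majorant (R : realType) (psi : R -> R) (a b e : R) :
  a < b -> 0 < e -> (forall x, a <= x <= b -> 0 <= psi x) ->
  mu.-integrable `[a, b] (EFin \o psi) ->
  exists v : R -> R, [/\
    forall x y, a <= x -> x <= y -> y <= b -> v x <= v y,
    v b - v a <= Rintegral mu `[a, b] psi + e &
    forall x, a < x < b ->
      \forall t \near x^'+, psi x * (t - x) <= v t - v x].
Proof.
move=> ab e0 psi0 ipsi.
pose D := `[a, b]%classic : set R.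
have mD : measurable D by exact: measurable_itv.
have mpsi : measurable_fun D psi.
  by case/integrableP : ipsi => /measurable_EFinP.
pose eps := e / (b - a + 1).
have b1 : 0 < b - a + 1 by lra.
have eps0 : 0 < eps by rewrite divr_gt0.
pose E (k : nat) : set R := D `&` psi @^-1` `[k%:R * eps, k.+1%:R * eps[.
have mE k : measurable (E k) by exact: mpsi.
have ED k : E k `<=` D by move=> x [].
have muD : mu D = (b - a)%:E.
  by rewrite lebesgue_measure_itv/= lte_fin ab -EFinD.
have muE k : (mu (E k) < +oo)%E.
  apply: (@le_lt_trans _ _ (mu D)); last by rewrite muD ltry.
  apply: le_measure; rewrite ?inE; [exact: mE|exact: mD|exact: ED].
pose del (k : nat) : R := (k.+1%:R * 2 ^+ k.+1)^-1.
have del0 k : 0 < del k by rewrite invr_gt0 mulr_gt0 ?exprn_gt0.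
have /choice[U HU] : forall k, exists A : set R,
    [/\ open A, E k `<=` A & (mu (A `\` E k) < (del k)%:E)%E].
  by move=> k; exact: lebesgue_regularity_outer (mE k) (muE k) (del0 k).
have mU k : measurable (U k) by case: (HU k) => oO _ _; exact: open_measurable.
pose c (k : nat) : R := k.+1%:R * eps.
have c0 k : 0 <= c k by rewrite mulr_ge0 ?(ltW eps0).
pose V (A : set R) : \bar R := (\sum_(0 <= k <oo) (c k)%:E * mu (U k `&` A))%E.
have t0 k A : (0 <= (c k)%:E * mu (U k `&` A))%E by rewrite mule_ge0 ?lee_fin.
have V0 A : (0 <= V A)%E by apply: nneseries_ge0 => k _ _.
have Vle A B : measurable A -> measurable B -> A `<=` B -> (V A <= V B)%E.
  move=> mA mB AB; apply: lee_nneseries => [//|k _].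
  apply: lee_wpmul2l; rewrite ?lee_fin//; apply: le_measure; rewrite ?inE.
  - exact: measurableI (mU k) mA.
  - exact: measurableI (mU k) mB.
  - exact: setIS.
have VU A B : measurable A -> measurable B -> A `&` B = set0 ->
    V (A `|` B) = (V A + V B)%E.
  move=> mA mB AB; rewrite /V -nneseriesD//.
  apply: eq_eseriesr => k _; rewrite setIUr measureU//.
  - by rewrite ge0_muleDr.
  - exact: measurableI (mU k) mA.
  - exact: measurableI (mU k) mB.
  - by rewrite setIACA AB setI0.
have psiE x : D x -> exists k, E k x.
  move=> Dx; have p0 : 0 <= psi x / eps.
    by rewrite divr_ge0 ?(ltW eps0)// psi0//; move: Dx; rewrite /D/= in_itv.
  exists (Num.truncn (psi x / eps)); split => //=; rewrite in_itv/=.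
  have /andP[h1 h2] := truncn_itv p0.
  by rewrite -ler_pdivlMr// h1 -ltr_pdivrMr// h2.
have UE : \bigcup_k E k = D.
  apply/seteqP; split => [x [k _ /ED]//|x /psiE[k Ek]]; by exists k.
have Etriv : trivIset setT E.
  apply/trivIsetP => i j _ _ ij; rewrite -subset0.
  move=> x [[_ /=]]; rewrite in_itv/= => /andP[i1 i2] [_ /=].
  rewrite in_itv/= => /andP[j1 j2].
  have := le_lt_trans i1 j2; rewrite ltr_pM2r// ltr_nat ltnS => ij'.
  have := le_lt_trans j1 i2; rewrite ltr_pM2r// ltr_nat ltnS => ji'.
  by move: ij; rewrite eqn_leq ij' ji'.
have ieps : mu.-integrable D (EFin \o cst eps).
  apply: measurable_bounded_integrable => //; last exact: bounded_cst.
  by change (mu D < +oo)%E; rewrite muD ltry.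
have ipe : mu.-integrable D (fun x => (psi x)%:E + eps%:E)%E.
  by apply: integrableD.
have VD : (V D <= (Rintegral mu D psi + e)%:E)%E.
  apply: (@le_trans _ _ (\sum_(0 <= k <oo)
    ((\int[mu]_(x in E k) ((psi x)%:E + eps%:E)) + (eps / (2 ^ k.+1)%:R)%:E))%E).
    apply: lee_nneseries => [//|k _].
    apply: (@le_trans _ _ ((c k)%:E * (mu (E k) + (del k)%:E))%E).
      apply: lee_wpmul2l; rewrite ?lee_fin//.
      apply: (@le_trans _ _ (mu (E k `|` (U k `\` E k)))).
        apply: le_measure; rewrite ?inE.
        - exact: measurableI (mU k) mD.
        - exact: measurableU (mE k) (measurableD (mU k) (mE k)).
        - move=> x [Ox _]; have [Ex|Ex] := pselect (E k x); by [left|right].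
      rewrite measureU; last 3 first.
      - exact: mE.
      - exact: measurableD (mU k) (mE k).
      - by apply/seteqP; split => // x [? []].
      by apply: leeD2l; apply: ltW; case: (HU k).
    rewrite ge0_muleDr//; last by rewrite lee_fin ltW.
    apply: leeD.
      have -> : ((c k)%:E * mu (E k) = \int[mu]_(x in E k) cst (c k)%:E x)%E.
        by rewrite integral_cst//; exact: mE.
      apply: ge0_le_integral.
      - exact: mE.
      - by move=> x _; rewrite lee_fin.
      - exact: measurable_cst.
      - apply: (measurable_funS mD); first exact: ED.
        by case/integrableP : ipe.
      - move=> x [Dx /=]; rewrite in_itv/= => /andP[h1 _].
        by rewrite -EFinD lee_fin /c -natr1 mulrDl mul1r lerD2r.
    rewrite -EFinM lee_fin /c /del natrX.
    by rewrite invfM mulrA [X in X / _]mulrAC divff ?pnatr_eq0// mul1r.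
  apply: le_trans; first apply: epsilon_trick => //.
  - move=> k; apply: integral_ge0 => x [Dx _].
    rewrite adde_ge0 ?lee_fin ?(ltW eps0)//.
    by apply: psi0; move: Dx; rewrite /D/= in_itv.
  - exact: ltW.
  rewrite -ge0_integral_bigcup//; last 2 first.
  - by rewrite UE; case/integrableP : ipe.
  - rewrite UE => x Dx; rewrite adde_ge0 ?lee_fin ?(ltW eps0)//.
    by apply: psi0; move: Dx; rewrite /D/= in_itv.
  rewrite UE integralD//.
  have -> : (\int[mu]_(x in D) eps%:E = (eps * (b - a))%:E)%E.
    by rewrite (EFinM eps) -muD; exact: integral_cst.
  rewrite /Rintegral.
  rewrite -[X in (X + _ + _)%E]fineK; last exact: integrable_fin_num.
  rewrite -!EFinD lee_fin -addrA lerD2l.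
  rewrite /eps -{2}(mulr1 (e / _)) -mulrDr divfK//; exact: lt0r_neq0.
have VDfin A : measurable A -> A `<=` D -> V A \is a fin_num.
  move=> mA AD; rewrite ge0_fin_numE//.
  by rewrite (le_lt_trans (Vle _ _ mA mD AD))// (le_lt_trans VD)// ltry.
pose v x := fine (V `[a, x]%classic).
have sub x : x <= b -> `[a, x]%classic `<=` D.
  by move=> xb; apply: subset_itvl; rewrite bnd_simp.
have vD x y : a <= x -> x <= y -> y <= b -> v y - v x = fine (V `]x, y]%classic).
  move=> ax xy yb; rewrite /v.
  have -> : `[a, y]%classic = `[a, x]%classic `|` `]x, y]%classic.
    by rewrite -itv_bndbnd_setU// bnd_simp.
  rewrite VU// ?fineD; first by rewrite addrAC subrr add0r.
  - by apply: VDfin => //; apply: sub; exact: le_trans yb.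
  - apply: VDfin => //; apply: subset_itv; rewrite bnd_simp//.
  - apply/seteqP; split => // z [/=]; rewrite !in_itv/= => /andP[_ zx] /andP[xz _].
    by move: zx; rewrite leNgt xz.
exists v; split.
- by move=> x y ax xy yb; rewrite -subr_ge0 vD// fine_ge0.
- apply: (@le_trans _ _ (v b)).
    by rewrite lerBlDr lerDl fine_ge0.
  rewrite -lee_fin fineK//; exact: VDfin.
- move=> x /andP[ax xb].
  have [k Ek] : exists k, E k x by apply: psiE; rewrite /D/= in_itv/= !ltW.
  have Ux : nbhs x (U k).
    by case: (HU k) => oU EU _; apply: open_nbhs_nbhs; split => //; exact: EU.
  have [d /= d0 dU] := (nbhs_ballP _ _).1 Ux.
  near=> t.
  have xt : x < t by near: t; exact: nbhs_right_gt.
  have tb : t < b by near: t; exact: nbhs_right_lt.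
  have td : t < x + d by near: t; apply: nbhs_right_lt; rewrite ltrDl.
  rewrite (vD x t (ltW ax) (ltW xt) (ltW tb)) -lee_fin fineK; last first.
    by apply: VDfin => //; apply: subset_itv; rewrite bnd_simp ltW.
  apply: (@le_trans _ _ ((c k)%:E * mu (U k `&` `]x, t]))%E).
    have -> : U k `&` `]x, t] = `]x, t]%classic.
      apply/setIidr => z /=; rewrite in_itv/= => /andP[xz zt]; apply: dU.
      rewrite /ball/= ltr0_norm ?subr_lt0// opprB ltrBlDl.
      exact: le_lt_trans td.
    rewrite lebesgue_measure_itv/= lte_fin xt -EFinD -EFinM lee_fin.
    rewrite ler_pM2r ?subr_gt0//.
    by case: Ek => _ /=; rewrite in_itv/= => /andP[_ /ltW].
  rewrite /V (nneseries_split _ k.+1)// add0n big_nat_recr//=.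
  rewrite -[leLHS]add0e -[leLHS]adde0; apply: leeD; last exact: nneseries_ge0.
  by apply: leeD => //; exact: sume_ge0.
Unshelve. all: by end_near. Qed.

Lemma increment_le_integral_ge0 (R : realType) (f df psi : R -> R) (a b : R) :
  a < b -> {within `[a, b], continuous f} ->
  (forall x, a < x < b -> is_derive x 1 f (df x)) ->
  (forall x, a < x < b -> df x <= psi x) ->
  (forall x, a <= x <= b -> 0 <= psi x) ->
  mu.-integrable `[a, b] (EFin \o psi) ->
  f b - f a <= Rintegral mu `[a, b] psi.
Proof.
move=> ab cf dfE dfpsi psi0 ipsi; apply/ler_addgt0Pr => e e0.
have e20 : 0 < e / 2 by rewrite divr_gt0.
have ba0 : 0 < b - a by rewrite subr_gt0.
have [v [vnd vba vloc]] := exists_majorant _ _ _ _ _ ab e20 psi0 ipsi.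
pose eta := e / 2 / (b - a).
have eta0 : 0 < eta by rewrite divr_gt0.
have : f b - f a <= (v b + eta * b) - (v a + eta * a).
  apply: (le_increment_of_local_right _ _ (fun x => v x + eta * x)) => //.
    move=> x y ax xy yb; apply: lerD; first exact: vnd.
    by rewrite ler_pM2l.
  move=> x xab.
  have [dx dxE] := dfE x xab.
  have : h^-1 *: (f (h *: 1 + x) - f x) @[h --> 0^'] --> df x by rewrite -dxE.
  move=> /cvgrPdist_lt/(_ _ eta0)/nbhs_ballP[d /= d0 Hd].
  have vx := vloc x xab.
  near=> t.
  have xt : x < t by near: t; exact: nbhs_right_gt.
  have td : t < x + d by near: t; apply: nbhs_right_lt; rewrite ltrDl.
  have vt : psi x * (t - x) <= v t - v x by near: t.
  have tx0 : 0 < t - x by rewrite subr_gt0.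
  have := Hd (t - x); rewrite /ball/= sub0r normrN gtr0_norm// ltrBlDl td.
  move=> /(_ isT); rewrite gt_eqF// => /(_ isT).
  rewrite [(t - x) *: 1]mulr1 subrK ltr_norml => /andP[+ _].
  rewrite ltrBrDl ltrBlDr.
  rewrite [_ *: _]mulrC ltr_pdivrMr// mulrDl => h.
  have : df x * (t - x) <= psi x * (t - x) by rewrite ler_pM2r// dfpsi.
  lra.
have : eta * (b - a) = e / 2 by rewrite /eta divfK// gt_eqF.
lra.
Unshelve. all: by end_near. Qed.

(* Truncating [df] below at [- n] and adding [n x] to [f] reduces to the
   nonnegative case; then [n] tends to infinity. *)
Lemma increment_le_integral (R : realType) (f df : R -> R) (a b : R) :
  a < b -> {within `[a, b], continuous f} ->
  (forall x, a < x < b -> is_derive x 1 f (df x)) ->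
  mu.-integrable `[a, b] (EFin \o df) ->
  f b - f a <= Rintegral mu `[a, b] df.
Proof.
move=> ab cf dfE idf.
pose g (n : nat) x := Num.max (df x) (- n%:R).
have mdf : measurable_fun `[a, b] df.
  by case/integrableP : idf => /measurable_EFinP.
have mg n : measurable_fun `[a, b] (g n).
  by apply: measurable_maxr.
have gdf n x : `|g n x| <= `|df x|.
  have n0 : 0 <= n%:R :> R by [].
  rewrite /g; case: (leP (df x) (- n%:R)) => // h.
  by rewrite normrN (ger0_norm n0) ler0_norm; lra.
have ig n : mu.-integrable `[a, b] (EFin \o g n).
  apply: le_integrable idf; first exact: measurable_itv.
    by apply/measurable_EFinP; have := mg n; exact.
  by move=> x _ /=; rewrite lee_fin; exact: gdf.
have ik (k : R) : mu.-integrable `[a, b] (EFin \o cst k).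
  apply: measurable_bounded_integrable => //; last exact: bounded_cst.
  change (mu `[a, b]%classic < +oo :> \bar R)%E.
  by rewrite lebesgue_measure_itv/= lte_fin ab -EFinD ltry.
have fg n : f b - f a <= Rintegral mu `[a, b] (g n).
  have : (f b + n%:R * b) - (f a + n%:R * a) <=
         Rintegral mu `[a, b] (fun x => g n x + n%:R).
    apply: (increment_le_integral_ge0 _ (fun x => f x + n%:R * x)
      (fun x => df x + n%:R)) => //.
    - move=> x; apply: cvgD; first exact: cf.
      apply: (@continuous_subspaceT _ _ _ (fun x : R => n%:R * x)) => y.
      exact: mulrl_continuous.
    - move=> x xab; apply: is_deriveD; first exact: dfE.
      by apply: is_derive_eq; rewrite [LHS]mulr1.
    - by move=> x xab; rewrite lerD2r /g le_max lexx.
    - by move=> x xab; rewrite -lerBlDr sub0r /g le_max lexx orbT.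
    - change (mu.-integrable `[a, b] (fun x => (g n x)%:E + (cst n%:R x)%:E)%E).
      by apply: integrableD => //; [exact: ig|exact: ik].
  have -> : Rintegral mu `[a, b] (fun x => g n x + n%:R) =
            Rintegral mu `[a, b] (g n) + Rintegral mu `[a, b] (cst n%:R).
    by apply: RintegralD; [exact: measurable_itv|exact: ig|exact: ik].
  have -> : Rintegral mu `[a, b] (cst n%:R) = n%:R * (b - a).
    rewrite [LHS]Rintegral_cst//; congr (_ * _).
    by have := lebesgue_measure_itv `[a, b]; rewrite /= lte_fin ab -EFinD => ->.
  lra.
have mgE n : measurable_fun `[a, b] (EFin \o g n) by apply/measurable_EFinP.
have mdfE : measurable_fun `[a, b] (EFin \o df) by apply/measurable_EFinP.
have gcvg : {ae mu, forall x, `[a, b]%classic x ->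
    (EFin \o g n) x @[n --> \oo] --> (EFin \o df) x}.
  apply: aeW => x _; apply: cvg_near_cst; near=> n.
  rewrite /g /= max_l// lerNl; apply: ltW.
  by near: n; exact: nbhs_infty_gtr.
have gdom : {ae mu, forall x n, `[a, b]%classic x ->
    (`|(EFin \o g n) x| <= `|(EFin \o df) x|)%E}.
  by apply: aeW => x n _; rewrite /= lee_fin; exact: gdf.
have [_ _ H] := @dominated_convergence _ _ _ mu _ (measurable_itv `[a, b])
  (fun n => EFin \o g n) (EFin \o df) _ mgE mdfE gcvg (integrable_abse idf) gdom.
rewrite -lee_fin fineK; last exact: integrable_fin_num.
apply: cvge_ge H; apply: nearW => n.
rewrite /= -[leRHS]fineK ?lee_fin//; [exact: fg|].
by apply: integrable_fin_num; [exact: measurable_itv|exact: ig].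
Unshelve. all: by end_near. Qed.

Lemma integral_derivative (R : realType) (f df : R -> R) (a b : R) :
  a <= b -> {within `[a, b], continuous f} ->
  (forall x, a < x < b -> is_derive x 1 f (df x)) ->
  mu.-integrable `[a, b] (EFin \o df) ->
  Rintegral mu `[a, b] df = f b - f a.
Proof.
rewrite le_eqVlt => /predU1P[->|ab] cf dfE idf.
  by rewrite set_itv1 Rintegral_set1 subrr.
apply/eqP; rewrite eq_le increment_le_integral// andbT.
have : (- f b) - (- f a) <= Rintegral mu `[a, b] (fun x => (-1) * df x).
  apply: (increment_le_integral _ (fun x => - f x)) => //.
  - by move=> x; apply: cvgN; exact: cf.
  - move=> x xab; rewrite mulN1r; apply: is_deriveN; exact: dfE.
  - under [X in _.-integrable _ X]eq_fun do rewrite /= EFinM.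
    exact: integrableZl.
rewrite RintegralZl//; lra.
Qed.

(** * Truncated powers and their convolutions *)

Definition tpow {R : realType} (r : nat) (x : R) : R :=
  if x < 0 then 0 else x ^+ r / r`!%:R.

Lemma tpow_lt0 (R : realType) r (x : R) : x < 0 -> tpow r x = 0.
Proof. by rewrite /tpow => ->. Qed.

Lemma tpow_ge0 (R : realType) r (x : R) : 0 <= x -> tpow r x = x ^+ r / r`!%:R.
Proof. by rewrite /tpow ltNge => ->. Qed.

Lemma measurable_tpow (R : realType) r : measurable_fun setT (@tpow R r).
Proof.
apply: measurable_fun_ifT => //.
- exact: measurable_fun_ltr.
- by apply: measurable_funM => //; exact: measurable_funX.
Qed.

Lemma norm_tpow_le (R : realType) r (M x : R) : 0 <= M -> x <= M ->
  `|tpow r x| <= M ^+ r / r`!%:R.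
Proof.
move=> M0 xM; have f0 : 0 <= r`!%:R^-1 :> R by rewrite invr_ge0.
rewrite /tpow; case: ltP => x0; first by rewrite normr0 mulr_ge0// exprn_ge0.
rewrite ger0_norm ?mulr_ge0 ?exprn_ge0//.
by rewrite ler_wpM2r// lerXn2r.
Qed.

Lemma tpow_lipschitz (R : realType) r (M x y : R) : 0 <= M -> x <= M -> y <= M ->
  `|tpow r.+1 x - tpow r.+1 y| <= M ^+ r * `|x - y|.
Proof.
move=> M0; wlog yx : x y / y <= x => [H xM yM|xM _].
  have /orP[h|h] := le_total y x; first exact: H.
  by rewrite distrC (distrC x) H.
have Mr : 0 <= M ^+ r by rewrite exprn_ge0.
have fct : (r.+1%:R : R) / r.+1`!%:R <= 1.
  rewrite factS natrM invfM mulrA divff ?pnatr_eq0// mul1r.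
  by rewrite invf_le1 ?ler1n ?ltr0n fact_gt0.
have fct1 : 0 <= (r.+1`!%:R : R)^-1 <= 1.
  by rewrite invr_ge0 ler0n/= invf_le1 ?ler1n ?ltr0n fact_gt0.
rewrite (ger0_norm (x := x - y)) ?subr_ge0//.
have [x0|x0] := ltP x 0.
  rewrite !tpow_lt0 ?(le_lt_trans yx)// subrr normr0.
  by rewrite mulr_ge0// subr_ge0.
have [y0|y0] := ltP y 0.
  rewrite (tpow_lt0 _ _ y)// tpow_ge0// subr0 ger0_norm; last first.
    by rewrite mulr_ge0 ?exprn_ge0// ; case/andP: fct1.
  apply: (@le_trans _ _ (x ^+ r.+1)).
    by rewrite ler_piMr ?exprn_ge0//; case/andP: fct1.
  rewrite exprSr; apply: ler_pM; rewrite ?exprn_ge0//; first by rewrite lerXn2r.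
  by rewrite lerDl oppr_ge0 ltW.
rewrite !tpow_ge0// -mulrBl subrXX.
have S0 : 0 <= \sum_(i < r.+1) x ^+ (r.+1.-1 - i) * y ^+ i.
  by apply: sumr_ge0 => i _; rewrite mulr_ge0 ?exprn_ge0.
have SM : \sum_(i < r.+1) x ^+ (r.+1.-1 - i) * y ^+ i <= r.+1%:R * M ^+ r.
  rewrite mulr_natl -[in leRHS](card_ord r.+1) -sumr_const.
  apply: ler_sum => i _; rewrite /=.
  rewrite -[in leRHS](subnK (leq_ord i)) exprD.
  have yM := le_trans yx xM.
  by apply: ler_pM; rewrite ?exprn_ge0// lerXn2r.
rewrite ger0_norm; last first.
  by rewrite !mulr_ge0 ?subr_ge0//; case/andP: fct1.
rewrite -mulrA mulrC ler_wpM2r ?subr_ge0//.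
apply: (@le_trans _ _ (r.+1%:R * M ^+ r / r.+1`!%:R)).
  by rewrite ler_wpM2r//; case/andP: fct1.
by rewrite mulrAC ler_piMl.
Qed.

Lemma tpow_dq (R : realType) r (y : R) : (0 < r)%N || (y != 0) ->
  h^-1 *: (tpow r.+1 (h + y) - tpow r.+1 y) @[h --> 0^'] --> tpow r y.
Proof.
have [y0|y0|->] := ltgtP y 0.
- move=> _; rewrite tpow_lt0//; apply: cvg_near_cst.
  near=> h; rewrite !tpow_lt0// ?subrr ?scaler0//.
  have : `|h| < - y by near: h; apply: dnbhs0_lt; rewrite oppr_gt0.
  rewrite ltr_norml; lra.
- move=> _.
  have H : is_derive y 1 (fun x : R => x ^+ r.+1 / r.+1`!%:R) (tpow r y).
    have -> : (fun x : R => x ^+ r.+1 / r.+1`!%:R) =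
              (r.+1`!%:R^-1 : R) \*: (@id R ^+ r.+1).
      by apply/funext => x; rewrite !fctE mulrC.
    apply: is_derive_eq.
    rewrite tpow_ge0 ?(ltW y0)//= factS natrM /GRing.scale/=; field.
    by rewrite nat1r !pnatr_eq0 -lt0n fact_gt0.
  have [d dE] := H.
  have : h^-1 *: ((h *: 1 + y) ^+ r.+1 / r.+1`!%:R - y ^+ r.+1 / r.+1`!%:R)
      @[h --> 0^'] --> tpow r y.
    by rewrite -dE.
  apply: cvg_trans; apply: near_eq_cvg; near=> h.
  rewrite [h *: 1]mulr1 !tpow_ge0 ?(ltW y0)//.
  have : `|h| < y by near: h; exact: dnbhs0_lt.
  rewrite ltr_norml; lra.
- rewrite orbF => r0; rewrite (tpow_ge0 _ r)// expr0n gtn_eqF// mul0r.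
  apply/cvgrPdist_lt => e e0; near=> h.
  have h0 : h != 0 by near: h; exact: nbhs_dnbhs_neq.
  have he : `|h| < e by near: h; exact: dnbhs0_lt.
  have h1 : `|h| < 1 by near: h; apply: dnbhs0_lt.
  rewrite sub0r normrN normrM addr0 normfV mulrC ltr_pdivrMr ?normr_gt0//.
  have := @tpow_lipschitz R r `|h| h 0 (normr_ge0 _) (ler_norm _) (normr_ge0 _).
  rewrite subr0.
  move=> /le_lt_trans; apply; rewrite ltr_pM2r ?normr_gt0//.
  apply: le_lt_trans he; case: r r0 => // r _.
  by rewrite exprS ler_piMr// exprn_ile1// ltW.
Unshelve. all: by end_near. Qed.

Lemma tpow_dq_right (R : realType) r (y : R) :
  h^-1 *: (tpow r.+1 (h + y) - tpow r.+1 y) @[h --> 0^'+] --> tpow r y.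
Proof.
have [|] := boolP ((0 < r)%N || (y != 0)).
  by move=> /tpow_dq; exact: cvg_dnbhs_at_right.
rewrite negb_or negbK -eqn0Ngt => /andP[/eqP-> /eqP->].
rewrite [tpow 0 0]tpow_ge0// expr0 fact0 divr1.
apply: cvg_near_cst; near=> h.
have h0 : 0 < h by near: h; exact: nbhs_right_gt.
rewrite addr0 !tpow_ge0 ?(ltW h0)// !expr1 mul0r subr0 !divr1.
by rewrite [_ *: _]mulVf// gt_eqF.
Unshelve. all: by end_near. Qed.

Lemma integrable_tpow_mul (R : realType) r (f : R -> R) (a T x : R) :
  mu.-integrable `[a, T] (EFin \o f) ->
  mu.-integrable `[a, T] (EFin \o (fun s => tpow r (x - s) * f s)).
Proof.
move=> fi.
have : mu.-integrable `[a, T] ((EFin \o (fun s => tpow r (x - s))) \* (EFin \o f))%E.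
  apply: integrableMr => //.
  - apply: (@measurable_funS _ _ _ _ setT) => //.
    apply: (measurableT_comp (measurable_tpow R r)).
    by apply: measurable_funB.
  - exists (`|x - a| ^+ r / r`!%:R); split; first exact: num_real.
    move=> N hN s /=; rewrite in_itv/= => /andP[as_ sT].
    apply: le_trans (ltW hN); apply: norm_tpow_le => //.
    by apply: le_trans (ler_norm _); rewrite lerD2l lerN2.
by [].
Qed.

Lemma Rintegral_tpow_widen (R : realType) r (f : R -> R) (a T x : R) : x <= T ->
  Rintegral mu `[a, x] (fun s => tpow r (x - s) * f s) =
  Rintegral mu `[a, T] (fun s => tpow r (x - s) * f s).
Proof.
move=> xT; rewrite Rintegral_mkcond [RHS]Rintegral_mkcond.
apply: eq_Rintegral => s _; rewrite !patchE.
have [sx|] := boolP (s \in `[a, x]%classic).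
  rewrite ifT//; move: sx; rewrite !inE/= !in_itv/= => /andP[-> sx].
  exact: le_trans xT.
rewrite notin_setE/= in_itv/= => /negP.
case: ifPn => //; rewrite inE/= in_itv/= => /andP[-> sT] /=.
by rewrite -ltNge => sx; rewrite tpow_lt0 ?mul0r// subr_lt0.
Qed.

(* Dominated convergence: the difference quotients of [tpow r.+1] are bounded
   and converge to [tpow r] except at the kink [s = x]. *)
Lemma Rintegral_tpow_dq (R : realType) r (f : R -> R) (a x : R) :
  (forall T, mu.-integrable `[a, T] (EFin \o f)) ->
  let K r x := Rintegral mu `[a, x] (fun s => tpow r (x - s) * f s) in
  h^-1 *: (K r.+1 (h + x) - K r.+1 x) @[h --> 0^'] --> K r x.
Proof.
move=> fi K; apply/cvgr_dnbhsP => u [u0 ucvg].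
have [B HB] : exists B, forall n, `|u n| <= B.
  have /cvg_seq_bounded[B [_ HB]] : cvgn u by apply/cvg_ex; exists 0.
  by exists (B + 1) => n; apply: HB => //; rewrite ltrDl.
pose T := x + B.
have B0 : 0 <= B by apply: le_trans (HB 0%N).
have uB n : u n <= B by apply: le_trans (HB n); exact: ler_norm.
pose k q y s := tpow q (y - s) * f s.
have ik q y : mu.-integrable `[a, T] (EFin \o k q y) by exact: integrable_tpow_mul.
have KT q y : y <= T -> K q y = Rintegral mu `[a, T] (k q y).
  exact: Rintegral_tpow_widen.
pose g n s := (u n)^-1 * (k r.+1 (u n + x) s - k r.+1 x s).
have ikB n : mu.-integrable `[a, T] (EFin \o (fun s => k r.+1 (u n + x) s - k r.+1 x s)).
  have : mu.-integrable `[a, T] ((EFin \o k r.+1 (u n + x)%R) \- (EFin \o k r.+1 x))%E.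
    by apply: integrableB; [exact: measurable_itv|exact: ik|exact: ik].
  by [].
have ig n : mu.-integrable `[a, T] (EFin \o g n).
  have : mu.-integrable `[a, T] (fun s => (u n)^-1%:E *
      (EFin \o (fun s => k r.+1 (u n + x)%R s - k r.+1 x s)%R) s)%E.
    by apply: integrableZl; [exact: measurable_itv|exact: ikB].
  by [].
have mg n : measurable_fun `[a, T] (EFin \o g n).
  by case/integrableP : (ig n).
have mk : measurable_fun `[a, T] (EFin \o k r x).
  by case/integrableP : (ik r x).
pose M := `|T - a|.
have dom : {ae mu, forall s n, `[a, T]%classic s ->
    (`|(EFin \o g n) s| <= (M ^+ r)%:E * `|(EFin \o f) s|)%E}.
  apply: aeW => s n; rewrite /= in_itv/= => /andP[as_ sT].
  rewrite lee_fin /g /k -mulrBl mulrA normrM ler_wpM2r// normrM normfV.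
  rewrite mulrC ler_pdivrMr ?normr_gt0//.
  have := @tpow_lipschitz R r M (u n + x - s) (x - s) (normr_ge0 _).
  rewrite [X in _ * `|X|](_ : _ = u n); last by lra.
  have TM : T - a <= M by exact: ler_norm.
  apply; last by rewrite /T in TM; lra.
  by have := uB n; rewrite /T in TM; lra.
have iF : mu.-integrable `[a, T] (fun s => (M ^+ r)%:E * `|(EFin \o f) s|)%E.
  apply: integrableZl; first exact: measurable_itv.
  by apply: integrable_abse; exact: fi.
have gcvg : {ae mu, forall s, `[a, T]%classic s ->
    (EFin \o g n) s @[n --> \oo] --> (EFin \o k r x) s}.
  exists [set x]; split; [exact: measurable_set1|exact: lebesgue_measure_set1|].
  move=> s /= hs; apply: contrapT => sx; apply: hs => _.
  apply: cvg_EFin; first exact: nearW.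
  have xs : x - s != 0 by rewrite subr_eq0; apply/eqP => xs; apply: sx.
  have : h^-1 *: (tpow r.+1 (h + (x - s)) - tpow r.+1 (x - s)) @[h --> 0^']
      --> tpow r (x - s).
    by apply: tpow_dq; rewrite xs orbT.
  move=> /cvgr_dnbhsP/(_ u (conj u0 ucvg)) H.
  suff : g n s @[n --> \oo] --> k r x s by [].
  have -> : (fun n => g n s) = (fun n =>
      ((u n)^-1 *: (tpow r.+1 (u n + (x - s)) - tpow r.+1 (x - s))) * f s).
    by apply/funext => n; rewrite /g /k -mulrBl mulrA addrA.
  by apply: cvgM => //; exact: cvg_cst.
have [_ _ H] := @dominated_convergence _ _ _ mu _ (measurable_itv `[a, T])
  (fun n => EFin \o g n) (EFin \o k r x) _ mg mk gcvg iF dom.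
have E n : (u n)^-1 *: (K r.+1 (u n + x) - K r.+1 x) = Rintegral mu `[a, T] (g n).
  rewrite KT; last by rewrite /T addrC lerD2l.
  rewrite KT; last by rewrite /T lerDl.
  rewrite -RintegralB; [|exact: measurable_itv|exact: ik|exact: ik].
  by rewrite [LHS]/GRing.scale/= -RintegralZl; [|exact: measurable_itv|exact: ikB].
under eq_fun do rewrite E.
rewrite KT; last by rewrite /T lerDl.
apply: fine_cvg; rewrite fineK; first exact: H.
by apply: integrable_fin_num; [exact: measurable_itv|exact: ik].
Qed.

(** * Matrix-valued limits and integrals *)

Lemma cvg_mxP (R : realType) (I : Type) (F : set_system I) m n
    (f : I -> 'M[R]_(m, n)) (l : 'M[R]_(m, n)) : Filter F ->
  (f @ F --> l) <-> forall i j, (fun x => f x i j) @ F --> l i j.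
Proof.
move=> FF; split=> [H i j|H].
  exact: (cvg_comp f (fun M : 'M[R]_(m, n) => M i j) H (@coord_continuous R m n i j l)).
apply/cvgrPdist_lt => e e0.
have : \forall x \near F, forall ij : 'I_m * 'I_n, `|l ij.1 ij.2 - f x ij.1 ij.2| < e.
  by apply: filter_forall => -[i j]; move/cvgrPdist_lt: (H i j) => /(_ _ e0).
apply: filterS => x Hx; rewrite /Num.norm/= mx_normrE.
by apply/bigmax_ltP; split => // ij _; rewrite !mxE; exact: Hx.
Qed.

Lemma is_derive_coord (R : realType) m n (M : R -> 'M[R]_(m, n)) (t : R) l i j :
  is_derive t (1 : R) M l -> is_derive t (1 : R) (fun s => M s i j) (l i j).
Proof.
move=> [dM <-]; apply: DeriveDef; first by move/derivable_mxP : dM; exact.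
by rewrite derive_mx// mxE.
Qed.

Lemma at_right_dnbhs (R : realType) (x : R) : x^'+ `=>` x^'.
Proof.
move=> A; rewrite /dnbhs /at_right /within /=.
by apply: filterS => y Ay y0; apply: Ay; rewrite gt_eqF.
Qed.

Definition mx_integrable {R : realType} {m n : nat} (D : set R) (F : R -> 'M[R]_(m, n)) :=
  forall i j, mu.-integrable D (EFin \o (fun s => F s i j)).

Definition mxint {R : realType} {m n : nat} (D : set R) (F : R -> 'M[R]_(m, n)) :=
  \matrix_(i, j) Rintegral mu D (fun s => F s i j).

Lemma integrable_sumr (R : realType) (D : set R) (I : Type) (s : seq I)
    (f : I -> R -> R) : measurable D ->
  (forall i, mu.-integrable D (EFin \o f i)) ->
  mu.-integrable D (EFin \o (fun x => \sum_(i <- s) f i x)) /\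
  Rintegral mu D (fun x => \sum_(i <- s) f i x) = \sum_(i <- s) Rintegral mu D (f i).
Proof.
move=> mD fi; elim: s => [|i s [IH1 IH2]].
  have -> : (fun x => \sum_(i <- [::]) f i x) = cst 0.
    by apply/funext => x; rewrite big_nil.
  split; first exact: integrable0.
  by rewrite big_nil /Rintegral integral0.
have -> : (fun x => \sum_(j <- i :: s) f j x) = (fun x => f i x + \sum_(j <- s) f j x).
  by apply/funext => x; rewrite big_cons.
split; last first.
  by rewrite big_cons -IH2; apply: RintegralD; [exact: mD|exact: fi|exact: IH1].
have : mu.-integrable D ((EFin \o f i) \+ (EFin \o (fun x => (\sum_(j <- s) f j x)%R)))%E.
  by apply: integrableD; [exact: mD|exact: fi|exact: IH1].
by [].
Qed.

Lemma integrable_scale (R : realType) (D : set R) (f : R -> R) (c : R) :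
  measurable D -> mu.-integrable D (EFin \o f) ->
  mu.-integrable D (EFin \o (fun x => c * f x)).
Proof.
move=> mD fi.
have : mu.-integrable D (fun s => c%:E * (EFin \o f) s)%E by apply: integrableZl.
by [].
Qed.

Lemma mxint_mulmxl (R : realType) m n p (D : set R) (A : 'M[R]_(m, n))
    (F : R -> 'M[R]_(n, p)) : measurable D -> mx_integrable D F ->
  mx_integrable D (fun s => A *m F s) /\
  mxint D (fun s => A *m F s) = A *m mxint D F.
Proof.
move=> mD Fi.
have key i j : mu.-integrable D (EFin \o (fun s => (A *m F s) i j)) /\
    Rintegral mu D (fun s => (A *m F s) i j) = (A *m mxint D F) i j.
  have -> : (fun s => (A *m F s) i j) = (fun s => \sum_k A i k * F s k j).
    by apply/funext => s; rewrite mxE.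
  have H k : mu.-integrable D (EFin \o (fun s => A i k * F s k j)).
    by apply: integrable_scale => //; exact: Fi.
  have [h1 h2] := integrable_sumr R D _ (index_enum _) _ mD H.
  split; first exact: h1.
  rewrite [LHS]h2 mxE; apply: eq_bigr => k _; rewrite mxE.
  by apply: RintegralZl => //; exact: Fi.
split; first by move=> i j; case: (key i j).
by apply/matrixP => i j; rewrite mxE; case: (key i j).
Qed.

Lemma mxint_mulmxr (R : realType) m n p (D : set R) (A : 'M[R]_(n, p))
    (F : R -> 'M[R]_(m, n)) : measurable D -> mx_integrable D F ->
  mxint D (fun s => F s *m A) = mxint D F *m A.
Proof.
move=> mD Fi; apply/matrixP => i j; rewrite !mxE.
have -> : (fun s => (F s *m A) i j) = (fun s => \sum_k A k j * F s i k).
  by apply/funext => s; rewrite mxE; apply: eq_bigr => k _; rewrite mulrC.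
have H k : mu.-integrable D (EFin \o (fun s => A k j * F s i k)).
  by apply: integrable_scale => //; exact: Fi.
have [_ ->] := integrable_sumr R D _ (index_enum _) _ mD H.
apply: eq_bigr => k _; rewrite mxE mulrC.
by apply: RintegralZl => //; exact: Fi.
Qed.

Lemma mxint_sum (R : realType) m n (D : set R) (I : Type) (s : seq I)
    (F : I -> R -> 'M[R]_(m, n)) : measurable D ->
  (forall i, mx_integrable D (F i)) ->
  mxint D (fun x => \sum_(i <- s) F i x) = \sum_(i <- s) mxint D (F i).
Proof.
move=> mD Fi; apply/matrixP => i j; rewrite summxE mxE.
have -> : (fun x => (\sum_(k <- s) F k x) i j) = (fun x => \sum_(k <- s) F k x i j).
  by apply/funext => x; rewrite summxE.
have [_ ->] := integrable_sumr R D _ s (fun k x => F k x i j) mD (fun k => Fi k i j).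
by apply: eq_bigr => k _; rewrite mxE.
Qed.

Lemma eq_mxint (R : realType) m n (D : set R) (F G : R -> 'M[R]_(m, n)) :
  (forall s, D s -> F s = G s) -> mxint D F = mxint D G.
Proof.
move=> FG; apply/matrixP => i j; rewrite !mxE.
by apply: eq_Rintegral => s; rewrite inE => /FG ->.
Qed.

Section frac_integral.
Variables (R : realType) (m n : nat) (a : R) (c : 'M[R]_(m, n)).
Variable F : R -> 'M[R]_(m, n).
Hypothesis Fi : forall T, mx_integrable `[a, T] F.

Definition frac (r : nat) (x : R) : 'M[R]_(m, n) :=
  tpow r (x - a) *: c + mxint `[a, x] (fun s => tpow r (x - s) *: F s).

Let tpow_scaleE r x i j :
  (fun s => (tpow r (x - s) *: F s) i j) = (fun s => tpow r (x - s) * F s i j).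
Proof. by apply/funext => s; rewrite mxE. Qed.

Lemma mx_integrable_tpow r (T x : R) :
  mx_integrable `[a, T] (fun s => tpow r (x - s) *: F s).
Proof.
move=> i j; rewrite tpow_scaleE.
by apply: integrable_tpow_mul; exact: Fi.
Qed.

Lemma mxint_tpow_widen r (T x : R) : x <= T ->
  mxint `[a, x] (fun s => tpow r (x - s) *: F s) =
  mxint `[a, T] (fun s => tpow r (x - s) *: F s).
Proof.
move=> xT; apply/matrixP => i j; rewrite !mxE tpow_scaleE.
exact: Rintegral_tpow_widen.
Qed.

Let fracE r x i j : frac r x i j = tpow r (x - a) * c i j +
  Rintegral mu `[a, x] (fun s => tpow r (x - s) * F s i j).
Proof. by rewrite !mxE tpow_scaleE. Qed.

Let frac_dq_filter (H : set_system R) r (x : R) : Filter H -> H `=>` 0^' ->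
  h^-1 *: (tpow r.+1 (h + (x - a)) - tpow r.+1 (x - a)) @[h --> H]
    --> tpow r (x - a) ->
  h^-1 *: (frac r.+1 (h + x) - frac r.+1 x) @[h --> H] --> frac r x.
Proof.
move=> FH H0 Ht; apply/cvg_mxP => i j; rewrite fracE.
have HK : h^-1 *: (Rintegral mu `[a, h + x] (fun s => tpow r.+1 (h + x - s) * F s i j)
      - Rintegral mu `[a, x] (fun s => tpow r.+1 (x - s) * F s i j)) @[h --> H]
    --> Rintegral mu `[a, x] (fun s => tpow r (x - s) * F s i j).
  move=> A /(Rintegral_tpow_dq R r _ a x (fun T => Fi T i j)); exact: H0.
apply: cvg_trans (cvgD (cvgM Ht (@cvg_cst _ (c i j) _ H _)) HK).
apply: near_eq_cvg; apply: nearW => h.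
have E (U V : 'M[R]_(m, n)) (k : R) : (k *: (U - V)) i j = k * (U i j - V i j).
  by rewrite !mxE.
rewrite E !fracE -(addrA h x (- a)) fctE /GRing.scale /=.
by ring.
Qed.

Lemma frac_dq r (x : R) : (0 < r)%N || (x != a) ->
  h^-1 *: (frac r.+1 (h + x) - frac r.+1 x) @[h --> 0^'] --> frac r x.
Proof.
move=> rx; apply: frac_dq_filter; first by [].
by apply: tpow_dq; rewrite subr_eq0.
Qed.

Lemma frac_dq_right r (x : R) :
  h^-1 *: (frac r.+1 (h + x) - frac r.+1 x) @[h --> 0^'+] --> frac r x.
Proof.
apply: frac_dq_filter; last exact: tpow_dq_right.
exact: at_right_dnbhs.
Qed.

End frac_integral.
Arguments frac {R m n}.

Lemma frac_comm (R : realType) n (a x : R) (A c : 'M[R]_n) (F : R -> 'M[R]_n) r :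
  (forall T, mx_integrable `[a, T] F) -> A *m c = c *m A ->
  (forall s, a <= s <= x -> A *m F s = F s *m A) ->
  A *m frac a c F r x = frac a c F r x *m A.
Proof.
move=> Fi Ac AF; have Ft := mx_integrable_tpow R n n a F Fi r x x.
rewrite /frac mulmxDr mulmxDl -scalemxAr -scalemxAl Ac; congr (_ + _).
rewrite -(mxint_mulmxr _ _ _ _ _ _ _ _ Ft)//.
have [_ <-] := mxint_mulmxl _ _ _ _ _ A _ (measurable_itv `[a, x]) Ft.
apply: eq_mxint => s /=; rewrite in_itv/= => sx.
by rewrite -scalemxAr -scalemxAl AF.
Qed.

Lemma is_derive_dqP (R : realType) (V : normedModType R) (f : R -> V) (t : R) (l : V) :
  is_derive t (1 : R) f l <-> h^-1 *: (f (h + t) - f t) @[h --> 0^'] --> l.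
Proof.
have E : (fun h : R => h^-1 *: (f (h *: (1 : R) + t) - f t)) =
         (fun h => h^-1 *: (f (h + t) - f t)).
  by apply/funext => h; rewrite [h *: _]mulr1.
split=> [[df <-]|H].
  by move: df; rewrite /derivable /derive /= E.
apply: DeriveDef.
  by rewrite /derivable /= E; apply/cvg_ex; exists l.
by rewrite /derive /= E; apply: cvg_lim.
Qed.

Lemma cvg_near_eq (I : Type) (T : topologicalType) (F : set_system I)
    (f g : I -> T) (l : T) :
  Filter F -> (\forall x \near F, f x = g x) -> f @ F --> l -> g @ F --> l.
Proof.
move=> FF fg H; apply: cvg_trans H; apply: near_eq_cvg.
by apply: filterS fg => x ->.
Qed.

Lemma dq_cvg_continuous (R : realType) (V : normedModType R) (H : set_system R)
    (f : R -> V) (y l : V) : Filter H -> H `=>` 0^' ->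
  h^-1 *: (f h - y) @[h --> H] --> l -> f h @[h --> H] --> y.
Proof.
move=> FH H0 Hl; apply/subr_cvg0.
have hid : h @[h --> H] --> (0 : R).
  move=> A A0; apply: H0; exact: (@nbhs_dnbhs R 0 A A0).
have HZ := cvgZ hid Hl; rewrite scale0r in HZ.
apply: cvg_near_eq (HZ _).
have : \forall h \near H, h != 0.
  by apply: (H0 (fun h => h != 0)); exact: (@nbhs_dnbhs_neq R 0).
by apply: filterS => h h0; rewrite scalerA divff// scale1r.
Qed.

Lemma at_left_dnbhs (R : realType) (x : R) : x^'- `=>` x^'.
Proof.
move=> A; rewrite /dnbhs /at_left /within /=.
by apply: filterS => y Ay y0; apply: Ay; rewrite lt_eqF.
Qed.

Lemma cvg_at_right_shift0 (R : realType) (V : normedModType R)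
    (f : R -> V) (a : R) (l : V) :
  f (a + h) @[h --> 0^'+] --> l -> f x @[x --> a^'+] --> l.
Proof.
move=> H A /H; rewrite /at_right /within /= => /nbhs_ballP[e e0 He].
apply/nbhs_ballP; exists e => // x xe ax.
have := He (x - a); rewrite /= (addrC a) subrK subr_gt0; apply => //.
by move: xe; rewrite /ball/= sub0r normrN distrC.
Qed.

Lemma cvg_at_left_shift0 (R : realType) (V : normedModType R)
    (f : R -> V) (a : R) (l : V) :
  f (a + h) @[h --> 0^'-] --> l -> f x @[x --> a^'-] --> l.
Proof.
move=> H A /H; rewrite /at_left /within /= => /nbhs_ballP[e e0 He].
apply/nbhs_ballP; exists e => // x xe ax.
have := He (x - a); rewrite /= (addrC a) subrK subr_lt0; apply => //.
by move: xe; rewrite /ball/= sub0r normrN distrC.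
Qed.

Lemma cvg_bigsum (R : realType) (V : normedModType R) (I J : Type) (H : set_system I)
    (s : seq J) (f : J -> I -> V) (l : J -> V) : Filter H ->
  (forall j, f j x @[x --> H] --> l j) ->
  (\sum_(j <- s) f j x) @[x --> H] --> \sum_(j <- s) l j.
Proof.
move=> FH Hf; elim: s => [|j s IH].
  under eq_fun do rewrite big_nil; rewrite big_nil; exact: cvg_cst.
under eq_fun do rewrite big_cons; rewrite big_cons; exact: cvgD.
Qed.

Lemma cvg_mulmxl (R : realType) (I : Type) (H : set_system I) m n p
    (A : 'M[R]_(m, n)) (f : I -> 'M[R]_(n, p)) (l : 'M[R]_(n, p)) : Filter H ->
  f @ H --> l -> A *m f x @[x --> H] --> A *m l.
Proof.
move=> FH /cvg_mxP Hf; apply/cvg_mxP => i j; rewrite mxE.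
under eq_fun do rewrite mxE.
apply: (cvg_bigsum R R^o) => k; apply: cvgM; [exact: cvg_cst|exact: Hf].
Qed.

Lemma cvg_mulmxr (R : realType) (I : Type) (H : set_system I) m n p
    (A : 'M[R]_(n, p)) (f : I -> 'M[R]_(m, n)) (l : 'M[R]_(m, n)) : Filter H ->
  f @ H --> l -> f x *m A @[x --> H] --> l *m A.
Proof.
move=> FH /cvg_mxP Hf; apply/cvg_mxP => i j; rewrite mxE.
under eq_fun do rewrite mxE.
apply: (cvg_bigsum R R^o) => k; apply: cvgM; [exact: Hf|exact: cvg_cst].
Qed.

Lemma dq_comm (R : realType) n (H : set_system R) (A l : 'M[R]_n) (t : R)
    (f : R -> 'M[R]_n) : ProperFilter H ->
  h^-1 *: (f (t + h) - f t) @[h --> H] --> l ->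
  A *m f t = f t *m A -> (\forall h \near H, A *m f (t + h) = f (t + h) *m A) ->
  A *m l = l *m A.
Proof.
move=> FH Hl At Ah.
have H1 := cvg_mulmxl R R H n n n A _ l _ Hl.
have H2 := cvg_mulmxr R R H n n n A _ l _ Hl.
have H3 : (h^-1 *: (f (t + h) - f t)) *m A @[h --> H] --> A *m l.
  apply: (cvg_near_eq _ 'M[R]_n H (fun h => A *m (h^-1 *: (f (t + h) - f t)))).
    apply: filterS Ah => h Ah.
    by rewrite -scalemxAr -scalemxAl mulmxBr mulmxBl At Ah.
  exact: H1.
exact: (@cvg_unique _ (@norm_hausdorff R 'M[R]_n) _ _ _ _ H3 (H2 _)).
Qed.

Lemma Zfun_tpow (R : realType) d (sigma : R) (A0 A1 : 'M[R]_d) n (t : R) :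
  0 < sigma -> t < n%:R * sigma ->
  Zfun sigma A0 A1 t =
  \sum_(r < n.+1) tpow r (t - r%:R * sigma - - sigma) *: Qmat A0 A1 r.
Proof.
move=> s0 tn; rewrite /Zfun; case: ltP => ts.
  rewrite big1// => r _; rewrite tpow_lt0 ?scale0r//.
  have : 0 <= r%:R * sigma by rewrite mulr_ge0// ltW.
  lra.
have h0 : 0 <= t / sigma + 1.
  by rewrite -lerBlDr sub0r ler_pdivlMr// mulN1r.
have := truncn_itv h0; rewrite -/(Zidx sigma t); set u := Zidx sigma t => /andP[u1 u2].
have un : (u.+1 <= n.+1)%N.
  rewrite -(ltr_nat R); apply: le_lt_trans u1 _.
  by rewrite -natr1 ltrD2r ltr_pdivrMr.
rewrite (big_ord_widen _ (fun r =>
  ((t - (r%:R - 1) * sigma) ^+ r / (r `!)%:R) *: Qmat A0 A1 r) un).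
rewrite big_mkcond/=; apply: eq_bigr => r _.
have tE : t - (r%:R - 1) * sigma = t - r%:R * sigma - - sigma by ring.
have tE2 : t - r%:R * sigma - - sigma = (t / sigma + 1 - r%:R) * sigma.
  by field; exact: lt0r_neq0.
case: ifPn => [ru|].
  rewrite tE tpow_ge0// tE2 mulr_ge0 ?(ltW s0)// subr_ge0.
  by apply: le_trans u1; rewrite ler_nat -ltnS.
rewrite -leqNgt => ur; rewrite tpow_lt0 ?scale0r//.
rewrite tE2 pmulr_llt0// subr_lt0; apply: lt_le_trans u2 _.
by rewrite ler_nat.
Qed.

(** * The representation formula *)

Lemma integrable_piecewise (R : realType) (f g : R -> R) (a b T : R) : a <= b ->
  mu.-integrable `[a, b] (EFin \o f) -> mu.-integrable `[a, T] (EFin \o g) ->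
  mu.-integrable `[a, T] (EFin \o (fun s => if s <= b then f s else g s)).
Proof.
move=> ab fi gi; pose k s := if s <= b then f s else g s.
rewrite -[X in EFin \o X]/k.
have fi' : mu.-integrable `[a, b] (EFin \o k).
  apply: eq_integrable fi => // s; rewrite inE/= in_itv/= => /andP[_ sb].
  by rewrite /k sb.
have gi' : mu.-integrable `]b, T] (EFin \o k).
  have gi2 : mu.-integrable `]b, T] (EFin \o g).
    apply: integrableS gi; [exact: measurable_itv|exact: measurable_itv|].
    by apply: subset_itvr; rewrite bnd_simp.
  apply: eq_integrable gi2 => // s; rewrite inE/= in_itv/= => /andP[bs _].
  by rewrite /k leNgt bs.
have [Tb|bT] := leP T b.
  apply: integrableS fi'; [exact: measurable_itv|exact: measurable_itv|].
  by apply: subset_itvl; rewrite bnd_simp.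
have -> : `[a, T]%classic = `[a, b]%classic `|` `]b, T]%classic.
  by apply: itv_bndbnd_setU; rewrite bnd_simp// ltW.
case/integrableP : fi' => mf fy; case/integrableP : gi' => mg gy.
have mU : measurable_fun (`[a, b] `|` `]b, T]) (EFin \o k).
  by apply/measurable_funU.
apply/integrableP; split => //.
rewrite ge0_integral_setU//.
- by rewrite lte_add_pinfty.
- exact: measurableT_comp.
- apply/disj_setPS => s [/=]; rewrite !in_itv/= => /andP[_ sb] /andP[bs _].
  by move: bs; rewrite ltNge sb.
Qed.

Lemma Rintegral_split (R : realType) (f g k : R -> R) (a b T : R) :
  a <= b -> b <= T -> mu.-integrable `[a, T] (EFin \o k) ->
  (forall s, a <= s <= b -> k s = f s) -> (forall s, b < s <= T -> k s = g s) ->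
  Rintegral mu `[a, T] k = Rintegral mu `[a, b] f + Rintegral mu `[b, T] g.
Proof.
move=> ab bT ki kf kg.
have H := @Rintegral_itvB R k (BLeft a) (BRight T) b ki.
rewrite !bnd_simp in H; have {}H := H ab bT.
have -> : Rintegral mu `[a, b] f = Rintegral mu `[a, b] k.
  by apply: eq_Rintegral => s; rewrite inE/= in_itv/= => /kf ->.
have ki2 : mu.-integrable `]b, T] (EFin \o k).
  apply: integrableS ki; [exact: measurable_itv|exact: measurable_itv|].
  by apply: subset_itvr; rewrite bnd_simp.
have gi : mu.-integrable `]b, T] (EFin \o g).
  by apply: eq_integrable ki2 => // s; rewrite inE/= in_itv/= => /kg ->.
rewrite -(Rintegral_itv_obnd_cbnd gi).
have -> : Rintegral mu `]b, T] g = Rintegral mu `]b, T] k.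
  by apply: eq_Rintegral => s; rewrite inE/= in_itv/= => /kg ->.
by rewrite -H addrC subrK.
Qed.

Lemma mxint_split (R : realType) m n (F G K : R -> 'M[R]_(m, n)) (a b T : R) :
  a <= b -> b <= T -> mx_integrable `[a, T] K ->
  (forall s, a <= s <= b -> K s = F s) -> (forall s, b < s <= T -> K s = G s) ->
  mxint `[a, T] K = mxint `[a, b] F + mxint `[b, T] G.
Proof.
move=> ab bT Ki KF KG; apply/matrixP => i j; rewrite !mxE.
by apply: Rintegral_split => // s hs; [rewrite KF|rewrite KG].
Qed.

Lemma mxoint_eq0 (R : realType) d (F : R -> 'M[R]_d) (t : R) :
  t <= 0 -> (forall s, t < s <= 0 -> F s = 0) -> mxoint 0 t F = 0.
Proof.
move=> t0 F0; apply/matrixP => i j; rewrite !mxE /oint.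
have H : Rintegral mu `[t, 0] (fun s => F s i j) = 0.
  have E s : `]t, 0]%classic s -> F s i j = 0.
    by rewrite /= in_itv/= => /F0 ->; rewrite mxE.
  rewrite -Rintegral_itv_obnd_cbnd.
    rewrite (@eq_Rintegral _ _ _ _ _ (cst 0)); last by move=> s; rewrite inE => /E.
    by rewrite /Rintegral integral0.
  have i0 : mu.-integrable `]t, 0] (cst 0%E : R -> \bar R) by exact: integrable0.
  by apply: eq_integrable i0 => // s; rewrite inE => /E /= ->.
case: ifPn => [h|_]; last by rewrite H oppr0.
have -> : t = 0 by apply/eqP; rewrite eq_le t0 h.
by rewrite set_itv1 Rintegral_set1.
Qed.

Section formula.
Variables (R : realType) (d : nat) (sigma : R) (A0 A1 : 'M[R]_d).
Variables (G Psi dPsi : R -> 'M[R]_d).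
Hypothesis s0 : 0 < sigma.

Definition forcing (s : R) : 'M[R]_d := if s <= 0 then dPsi s else Gstar G s.

Hypothesis Fi : forall T, mx_integrable `[- sigma, T] forcing.

Let W := frac (- sigma) (Psi (- sigma)) forcing.

Lemma Xformula_frac n t : - sigma <= t -> t < n%:R * sigma ->
  Xformula sigma A0 A1 G Psi dPsi t =
  \sum_(r < n.+1) Qmat A0 A1 r *m W r (t - r%:R * sigma).
Proof.
move=> ts tn.
have rs0 r : 0 <= r%:R * sigma by rewrite mulr_ge0// ltW.
have ZE s (M : 'M[R]_d) : - sigma <= s -> Zfun sigma A0 A1 (t - sigma - s) *m M =
    \sum_(r < n.+1) Qmat A0 A1 r *m (tpow r (t - r%:R * sigma - s) *: M).
  move=> ss; rewrite (Zfun_tpow _ _ _ _ _ n)//; last by lra.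
  rewrite mulmx_suml; apply: eq_bigr => r _.
  rewrite -scalemxAl -scalemxAr; congr (tpow _ _ *: _); ring.
have Ki (r : nat) T : mx_integrable `[- sigma, T]
    (fun s => tpow r (t - r%:R * sigma - s) *: forcing s).
  exact: mx_integrable_tpow.
have Ki0 (r : nat) T : mx_integrable `[- sigma, T]
    (fun s => Qmat A0 A1 r *m (tpow r (t - r%:R * sigma - s) *: forcing s)).
  by case: (mxint_mulmxl R _ _ _ _ (Qmat A0 A1 r) _
    (measurable_itv `[- sigma, T]) (Ki r T)).
pose S s := \sum_(r < n.+1) Qmat A0 A1 r *m (tpow r (t - r%:R * sigma - s) *: forcing s).
have SiT T : mx_integrable `[- sigma, T] S.
  move=> i j.
  have -> : (fun s => S s i j) = (fun s => \sum_(r < n.+1)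
      (Qmat A0 A1 r *m (tpow r (t - r%:R * sigma - s) *: forcing s)) i j).
    by apply/funext => s; rewrite summxE.
  by have [] := integrable_sumr R _ _ (index_enum _) (fun (r : 'I_n.+1) s =>
      (Qmat A0 A1 r *m (tpow r (t - r%:R * sigma - s) *: forcing s)) i j)
    (measurable_itv `[- sigma, T]) (fun r => Ki0 r T i j).
have main : mxoint (- sigma) 0 (fun s => Zfun sigma A0 A1 (t - sigma - s) *m dPsi s)
    + mxoint 0 t (fun s => Zfun sigma A0 A1 (t - sigma - s) *m Gstar G s)
    = mxint `[- sigma, Num.max 0 t] S.
  have E1 : mxoint (- sigma) 0 (fun s => Zfun sigma A0 A1 (t - sigma - s) *m dPsi s) =
      mxint `[- sigma, 0] (fun s => Zfun sigma A0 A1 (t - sigma - s) *m dPsi s).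
    by apply/matrixP => i j; rewrite !mxE /oint oppr_le0 ltW.
  have [t0|t0] := leP 0 t.
    have E2 : mxoint 0 t (fun s => Zfun sigma A0 A1 (t - sigma - s) *m Gstar G s) =
      mxint `[0, t] (fun s => Zfun sigma A0 A1 (t - sigma - s) *m Gstar G s).
      by apply/matrixP => i j; rewrite !mxE /oint t0.
    rewrite E1 E2; apply/esym/mxint_split => //.
    - by rewrite oppr_le0 ltW.
    - move=> s /andP[h1 h2]; rewrite ZE//; apply: eq_bigr => r _.
      by rewrite /forcing h2.
    - move=> s /andP[h1 h2]; rewrite ZE; last first.
        by apply: le_trans (ltW h1); rewrite oppr_le0 ltW.
      by apply: eq_bigr => r _; rewrite /forcing leNgt h1.
  rewrite mxoint_eq0 ?addr0 ?(ltW t0)//; last first.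
    move=> s /andP[h1 h2]; rewrite /Zfun ifT ?mul0mx//; lra.
  rewrite E1; apply: eq_mxint => s /=; rewrite in_itv/= => /andP[h1 h2].
  by rewrite ZE//; apply: eq_bigr => r _; rewrite /forcing h2.
rewrite /Xformula -addrA main (Zfun_tpow _ _ _ _ _ n)// mulmx_suml.
rewrite /S mxint_sum//.
rewrite -big_split; apply: eq_bigr => r _ /=.
rewrite /W /frac mulmxDr -scalemxAl -scalemxAr; congr (_ + _).
have [_ ->] := mxint_mulmxl R _ _ _ _ (Qmat A0 A1 r) _
  (measurable_itv `[- sigma, Num.max 0 t]) (Ki r (Num.max 0 t)).
rewrite -mxint_tpow_widen//.
by rewrite le_max; apply/orP; right; have := rs0 r; lra.
Qed.

End formula.
Arguments forcing {R d}.

Lemma continuous_Gstar (R : realType) d (G : R -> 'M[R]_d) i j :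
  {within `[0, +oo[, continuous G} -> continuous (fun s => Gstar G s i j).
Proof.
move=> /subspace_continuousP cG x.
have E s : Gstar G s = G (Num.max s 0) by rewrite /Gstar; case: ltP.
have H : G @ within `[0, +oo[ (nbhs (Num.max x 0)) --> G (Num.max x 0).
  by apply: cG; rewrite /= in_itv/= andbT le_max lexx orbT.
have Hm : Num.max s 0 @[s --> x] --> within `[0, +oo[ (nbhs (Num.max x 0)).
  have cm : Num.max s 0 @[s --> x] --> Num.max x 0.
    by apply: (@continuous_max R R id (cst 0) x); [exact: cvg_id|exact: cvg_cst].
  move=> A; rewrite /within /= => hA.
  have := cm _ hA; apply: (@filterS _ (nbhs x)) => s /=; apply.
  by rewrite in_itv/= andbT le_max lexx orbT.
have /cvg_mxP/(_ i j) := cvg_comp _ _ Hm H.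
by rewrite /continuous_at E; under [in X in _ -> X]eq_fun do rewrite E.
Qed.

Lemma integrable_continuous (R : realType) (g : R -> R) (a T : R) :
  continuous g -> mu.-integrable `[a, T] (EFin \o g).
Proof.
move=> cg; apply: continuous_compact_integrable; first exact: segment_compact.
exact: continuous_subspaceT.
Qed.

Section existence.
Variables (R : realType) (d : nat) (sigma : R) (A0 A1 : 'M[R]_d).
Variables (G Psi dPsi : R -> 'M[R]_d).
Hypothesis s0 : 0 < sigma.
Hypothesis cG : {within `[0, +oo[, continuous G}.
Hypothesis AG : forall t, 0 <= t -> A1 *m G t = G t *m A1.
Hypothesis dPsiE : forall t : R, - sigma < t < 0 -> is_derive t (1 : R) Psi (dPsi t).
Hypothesis dPsil :
  (fun h : R => h^-1 *: (Psi (- sigma + h) - Psi (- sigma))) @ (0 : R)^'+ --> dPsi (- sigma).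
Hypothesis dPsir :
  (fun h : R => h^-1 *: (Psi h - Psi 0)) @ (0 : R)^'- --> dPsi 0.
Hypothesis APsi : forall t, - sigma <= t <= 0 -> A1 *m Psi t = Psi t *m A1.
Hypothesis dPsii : mx_integrable `[- sigma, 0] dPsi.

Let sle0 : - sigma <= 0. Proof. by rewrite oppr_le0 ltW. Qed.

Local Notation F := (forcing G dPsi).
Local Notation W := (frac (- sigma) (Psi (- sigma)) F).
Local Notation X := (Xformula sigma A0 A1 G Psi dPsi).

Lemma forcing_integrable T : mx_integrable `[- sigma, T] F.
Proof.
move=> i j.
have -> : (fun s => F s i j) = (fun s => if s <= 0 then dPsi s i j else Gstar G s i j).
  by apply/funext => s; rewrite /forcing; case: ifP.
apply: integrable_piecewise; [exact: sle0|exact: dPsii|].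
by apply: integrable_continuous; exact: continuous_Gstar.
Qed.

Lemma dinitial_comm t : - sigma <= t <= 0 -> A1 *m dPsi t = dPsi t *m A1.
Proof.
move=> /andP[]; rewrite le_eqVlt => /predU1P[<- _|st].
  apply: (dq_comm _ _ _ _ _ _ _ _ dPsil).
    by apply: APsi; rewrite lexx.
  near=> h; apply: APsi; apply/andP; split.
    by rewrite lerDl; near: h; exact: nbhs_right_ge.
  by rewrite addrC subr_le0; near: h; exact: nbhs_right_le.
rewrite le_eqVlt => /predU1P[->|t0].
  have H : (fun h : R => h^-1 *: (Psi (0 + h) - Psi 0)) @ (0 : R)^'- --> dPsi 0.
    by under eq_fun do rewrite add0r.
  apply: (dq_comm _ _ _ _ _ _ _ _ H).
    by apply: APsi; rewrite lexx sle0.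
  near=> h; apply: APsi; rewrite add0r; apply/andP; split.
    by near: h; apply: nbhs_left_ge; rewrite oppr_lt0.
  by near: h; exact: nbhs_left_le.
have /dPsiE/is_derive_dqP : - sigma < t < 0 by rewrite st t0.
under eq_fun do rewrite (addrC _ t).
move=> H; apply: (dq_comm _ _ _ _ _ _ _ _ H); first by apply: APsi; rewrite !ltW.
near=> h.
have h1 : `|h| < t + sigma by near: h; apply: dnbhs0_lt; lra.
have h2 : `|h| < - t by near: h; apply: dnbhs0_lt; lra.
apply: APsi; move: h1 h2; rewrite !ltr_norml; lra.
Unshelve. all: by end_near. Qed.

Lemma forcing_comm s : - sigma <= s -> A1 *m F s = F s *m A1.
Proof.
move=> ss; rewrite /forcing; case: leP => s0'; first by apply: dinitial_comm; rewrite ss.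
by rewrite /Gstar ltNge (ltW s0')/= AG// ltW.
Qed.

Lemma frac_forcing_comm r x : A1 *m W r x = W r x *m A1.
Proof.
apply: frac_comm; first exact: forcing_integrable.
  by apply: APsi; rewrite lexx.
by move=> s /andP[ss _]; exact: forcing_comm.
Qed.

Lemma frac0E x : - sigma <= x ->
  W 0%N x = Psi (- sigma) + mxint `[- sigma, x] F.
Proof.
move=> sx; rewrite /frac tpow_ge0; last by rewrite opprK -lerBlDr sub0r.
rewrite expr0 fact0 divr1 scale1r; congr (_ + _).
apply: eq_mxint => s /=; rewrite in_itv/= => /andP[_ sx'].
by rewrite tpow_ge0 ?subr_ge0// expr0 fact0 divr1 scale1r.
Qed.

Lemma frac0_dq (H : set_system R) t : Filter H -> H `=>` 0^' -> 0 <= t ->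
  (\forall h \near H, 0 <= h + t) ->
  h^-1 *: (W 0%N (h + t) - W 0%N t) @[h --> H] --> G t.
Proof.
move=> FH H0 t0 Ht; apply/cvg_mxP => i j.
pose g s := Gstar G s i j.
have cg : continuous g by exact: continuous_Gstar.
pose P x := Rintegral mu `[- sigma, x] g.
have PE x : 0 <= x -> W 0%N x i j - P x = W 0%N 0 i j - P 0.
  move=> x0; rewrite !frac0E//; last exact: le_trans x0.
  rewrite !mxE.
  rewrite (Rintegral_split _ (fun s => F s i j) g _ _ 0 x)//.
  - rewrite /P (Rintegral_split _ g g g (- sigma) 0 x)//; first by ring.
    exact: integrable_continuous.
  - exact: forcing_integrable.
  - by move=> s /andP[s1 _]; rewrite /forcing leNgt s1.
have gt : g t = G t i j by rewrite /g /Gstar ltNge t0.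
have t1 : t < t + 1 by rewrite ltrDl.
have st : - sigma < t by apply: lt_le_trans t0; rewrite oppr_lt0.
have [Pd PE'] := @continuous_FTC1_closed R g (- sigma) t (t + 1) t1
  (integrable_continuous _ _ _ _ cg) st (cg t).
have PD : is_derive t 1 P (g t).
  by apply: DeriveDef; [exact: Pd|rewrite -derive1E].
have PH : h^-1 *: (P (h + t) - P t) @[h --> H] --> G t i j.
  rewrite -gt; move/is_derive_dqP : PD => PD A /PD; exact: H0.
apply: (cvg_near_eq _ R H (fun h => h^-1 *: (P (h + t) - P t))); last exact: PH.
apply: filterS Ht => h ht.
have E (U V : 'M[R]_d) (k : R) : (k *: (U - V)) i j = k * (U i j - V i j).
  by rewrite !mxE.
rewrite E /GRing.scale /=; congr (_ * _).
have := PE _ ht; have := PE _ t0; lra.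
Qed.

Lemma Xformula_dq (H : set_system R) t : Filter H -> H `=>` 0^' -> 0 <= t ->
  (\forall h \near H, 0 <= h + t) ->
  (forall r : nat, let x := t - r.+1%:R * sigma in
    h^-1 *: (W r.+1 (h + x) - W r.+1 x) @[h --> H] --> W r x) ->
  h^-1 *: (X (h + t) - X t) @[h --> H] --> rhs sigma A0 A1 G X t.
Proof.
move=> FH H0 t0 Ht HW.
have [n tn] : exists n : nat, t + 1 < n%:R * sigma.
  exists (Num.truncn ((t + 1) / sigma)).+1.
  rewrite -ltr_pdivrMr//.
  have h : 0 <= (t + 1) / sigma by rewrite divr_ge0 ?addr_ge0// ltW.
  by case/andP: (truncn_itv h).
have n0 : (0 < n)%N.
  by case: n tn => // /[!mul0r]; lra.
case: n n0 tn => // n _ tn.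
have XE x : 0 <= x < t + 1 ->
    X x = \sum_(r < n.+2) Qmat A0 A1 r *m W r (x - r%:R * sigma).
  move=> /andP[x0 xt]; apply: Xformula_frac => //; first exact: forcing_integrable.
    exact: le_trans x0.
  exact: lt_trans tn.
have Xt : X (t - sigma) = \sum_(r < n.+1) Qmat A0 A1 r *m W r (t - r.+1%:R * sigma).
  rewrite (@Xformula_frac _ _ _ _ _ _ _ _ s0 forcing_integrable n).
  - apply: eq_bigr => r _; congr (_ *m _); congr (W _ _).
    by rewrite -natr1; ring.
  - by rewrite lerDr.
  - by move: tn; rewrite -natr1; lra.
pose L (r : nat) := if r is r'.+1 then W r' (t - r'.+1%:R * sigma) else G t.
have -> : rhs sigma A0 A1 G X t = \sum_(r < n.+2) Qmat A0 A1 r *m L r.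
  rewrite big_ord_recl /= mul1mx /rhs [RHS]addrC; congr (_ + _).
  rewrite Xt mulmx_sumr mulmx_suml -big_split; apply: eq_bigr => r _ /=.
  by rewrite mulmxDl !mulmxA; congr (_ + _); rewrite -!mulmxA frac_forcing_comm.
have HL : (\sum_(r < n.+2) Qmat A0 A1 r *m
      (h^-1 *: (W r (h + (t - r%:R * sigma)) - W r (t - r%:R * sigma)))) @[h --> H]
    --> \sum_(r < n.+2) Qmat A0 A1 r *m L r.
  apply: cvg_bigsum => r; apply: cvg_mulmxl.
  case: r => -[|r] _ /=; last exact: HW.
  by rewrite mul0r subr0; exact: frac0_dq.
apply: (cvg_near_eq _ _ _ _ _ _ _ _ HL).
have H1 : \forall h \near H, h < 1.
  apply: (H0 (fun h => h < 1)); apply: (@nbhs_dnbhs R 0 (fun h => h < 1)).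
  exact: lt_nbhsl.
apply: filterS2 Ht H1 => h h0 h1.
rewrite !XE; last 2 first.
- by rewrite t0/= ltrDl.
- by rewrite h0/= addrC ltrD2l.
rewrite -sumrB scaler_sumr; apply: eq_bigr => r _.
by rewrite -scalemxAr mulmxBr addrA.
Qed.

Lemma initial_within_continuous i j :
  {within `[- sigma, 0], continuous (fun s => Psi s i j)}.
Proof.
have s0' : - sigma < 0 by rewrite oppr_lt0.
apply/continuous_within_itvP => //; split.
- move=> x; rewrite in_itv/= => /dPsiE[dx _].
  apply: differentiable_continuous; apply/derivable1_diffP.
  by move/derivable_mxP : dx; exact.
- apply: (cvg_at_right_shift0 R R^o).
  have := dq_cvg_continuous _ _ _ _ _ _ _ (at_right_dnbhs R 0) dPsil.
  by move=> /(_ _)/cvg_mxP; exact.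
- apply: (cvg_at_left_shift0 R R^o).
  under eq_fun do rewrite add0r.
  have := dq_cvg_continuous _ _ _ _ _ _ _ (at_left_dnbhs R 0) dPsir.
  by move=> /(_ _)/cvg_mxP; exact.
Qed.

Lemma Xformula_initial t : - sigma <= t <= 0 -> X t = Psi t.
Proof.
move=> /andP[st t0].
rewrite (@Xformula_frac _ _ _ _ _ _ _ _ s0 forcing_integrable 1)//; last first.
  by rewrite mul1r; exact: le_lt_trans s0.
rewrite !big_ord_recl big_ord0 addr0 /= mul1mx mul0r subr0 mul1r.
have -> : W 1%N (t - sigma) = 0.
  rewrite /frac opprK subrK.
  have -> : tpow 1 t = 0.
    move: t0; rewrite le_eqVlt => /predU1P[->|t0]; last by rewrite tpow_lt0.
    by rewrite tpow_ge0// expr1 mul0r.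
  rewrite scale0r add0r; apply/matrixP => i j; rewrite !mxE.
  move: t0; rewrite le_eqVlt => /predU1P[->|t0].
    by rewrite sub0r set_itv1 Rintegral_set1.
  by rewrite set_itv_ge ?Rintegral_set0// bnd_simp -ltNge; lra.
rewrite mulmx0 addr0 frac0E//; apply/matrixP => i j; rewrite !mxE.
have -> : Rintegral mu `[- sigma, t] (fun s => F s i j) =
    Rintegral mu `[- sigma, t] (fun s => dPsi s i j).
  apply: eq_Rintegral => s; rewrite inE/= in_itv/= => /andP[_ s_t].
  by rewrite /forcing (le_trans s_t t0).
have sub : `[- sigma, t] `<=` `[- sigma, 0] by apply: subset_itvl; rewrite bnd_simp.
have -> : Rintegral mu `[- sigma, t] (fun s => dPsi s i j) =
    Psi t i j - Psi (- sigma) i j.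
  apply: (integral_derivative _ (fun s => Psi s i j)) => //.
  - exact: continuous_subspaceW (initial_within_continuous i j).
  - move=> x /andP[sx xt].
    by apply: is_derive_coord; apply: dPsiE; rewrite sx (lt_le_trans xt).
  - by apply: integrableS (dPsii i j); [exact: measurable_itv|exact: measurable_itv|].
by rewrite addrC subrK.
Qed.

Lemma Xformula_is_solution : is_solution sigma A0 A1 G Psi X.
Proof.
split; first exact: Xformula_initial; split.
- have -> : (fun h => h^-1 *: (X h - X 0)) = (fun h => h^-1 *: (X (h + 0) - X 0)).
    by apply/funext => h; rewrite addr0.
  apply: Xformula_dq; [exact: at_right_dnbhs|by []| |].
    by near=> h; rewrite addr0; near: h; exact: nbhs_right_ge.
  by move=> r x; apply: frac_dq_right; exact: forcing_integrable.
- move=> t t0; apply/is_derive_dqP; apply: Xformula_dq => //; first exact: ltW.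
    near=> h.
    have : `|h| < t by near: h; exact: dnbhs0_lt.
    by rewrite ltr_norml; lra.
  move=> r x; apply: frac_dq; first exact: forcing_integrable.
  case: r @x => //=; rewrite mul1r.
  by rewrite -subr_eq0 opprK subrK gt_eqF.
Unshelve. all: by end_near. Qed.

End existence.

Lemma is_solution_unique (R : realType) d (sigma : R) (A0 A1 : 'M[R]_d)
    (G Psi X Y : R -> 'M[R]_d) : 0 < sigma ->
  is_solution sigma A0 A1 G Psi X -> is_solution sigma A0 A1 G Psi Y ->
  forall t, - sigma <= t -> X t = Y t.
Proof.
move=> s0 [X0 [Xr Xd]] [Y0 [Yr Yd]].
have steps (n : nat) t : - sigma <= t <= n%:R * sigma -> X t = Y t.
  elim: n t => [|n IH] t /andP[st tn].
    by rewrite X0 ?Y0// st; rewrite mul0r in tn.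
  have [t0|t0] := leP t 0; first by rewrite X0 ?Y0// st.
  apply/matrixP => i j.
  have dZ s : 0 < s <= t -> is_derive s (1 : R) (fun s => (X s - Y s) i j) 0.
    move=> /andP[s_gt0 s_t].
    have E : rhs sigma A0 A1 G X s - rhs sigma A0 A1 G Y s = 0.
      rewrite /rhs IH ?subrr//; apply/andP; split; first by rewrite lerDr ltW.
      rewrite lerBlDr; apply: le_trans s_t (le_trans tn _).
      by rewrite -natr1 mulrDl mul1r.
    have := is_derive_coord _ _ _ _ _ _ i j (is_deriveB (Xd s s_gt0) (Yd s s_gt0)).
    by rewrite E mxE.
  have cZ : {within `[0, t], continuous (fun s => (X s - Y s) i j)}.
    have cd s : 0 < s <= t -> {for s, continuous (fun s => (X s - Y s) i j)}.
      move=> /dZ[ds _].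
      by apply: differentiable_continuous; apply/derivable1_diffP.
    apply/continuous_within_itvP => //; split.
    - by move=> s; rewrite in_itv/= => /andP[s1 s2]; apply: cd; rewrite s1 ltW.
    - have XY : X h - Y h @[h --> 0^'+] --> X 0 - Y 0.
        by apply: cvgB; apply: dq_cvg_continuous (at_right_dnbhs R 0) _; eassumption.
      by move/cvg_mxP : XY; exact.
    - apply: cvg_at_left_filter; apply: cd; by rewrite t0/=.
  have dZo s : s \in `]0, t[ -> is_derive s (1 : R) (fun s => (X s - Y s) i j) 0.
    by rewrite in_itv/= => /andP[s1 s2]; apply: dZ; rewrite s1 ltW.
  have [c cin] := MVT t0 dZo cZ.
  rewrite mul0r !mxE (X0 0) ?(Y0 0) ?lexx ?oppr_le0 ?(ltW s0)// subrr subr0.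
  by move/eqP; rewrite subr_eq0 => /eqP.
move=> t st; apply: (steps (Num.truncn (t / sigma)).+1); rewrite st/=.
rewrite -ler_pdivrMr//.
have [t0|t0] := leP 0 t.
  have h : 0 <= t / sigma by rewrite divr_ge0// ltW.
  by case/andP: (truncn_itv h) => _ /ltW.
by apply: le_trans (ler0n _ _); rewrite ler_pdivrMr// mul0r ltW.
Qed.

Theorem theorem7 (R : realType) (d : nat) (sigma : R) (A0 A1 : 'M[R]_d)
    (G Psi dPsi : R -> 'M[R]_d) :
  (0 < d)%N -> 0 < sigma ->
  {within `[0, +oo[, continuous G} ->
  (forall t, 0 <= t -> A1 *m G t = G t *m A1) ->
  (* Psi is differentiable on [-sigma, 0] with derivative dPsi
     (one-sided at the endpoints) *)
  (forall t : R, - sigma < t < 0 -> is_derive t (1:R) Psi (dPsi t)) ->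
  ((fun h : R => h^-1 *: (Psi (- sigma + h) - Psi (- sigma))) @ (0:R)^'+ --> dPsi (- sigma)) ->
  ((fun h : R => h^-1 *: (Psi h - Psi 0)) @ (0:R)^'- --> dPsi 0) ->
  (forall t, - sigma <= t <= 0 -> A1 *m Psi t = Psi t *m A1) ->
  (* needed for the integral of dPsi to make sense (see NOTES.md) *)
  (forall i j, lebesgue_measure.-integrable `[- sigma, 0] (fun s => (dPsi s i j)%:E)) ->
  is_solution sigma A0 A1 G Psi (Xformula sigma A0 A1 G Psi dPsi) /\
  (forall X, is_solution sigma A0 A1 G Psi X ->
     forall t, - sigma <= t -> X t = Xformula sigma A0 A1 G Psi dPsi t).
Proof.
move=> _ s0 cG AG dP dPl dPr AP dPi.
have Xsol : is_solution sigma A0 A1 G Psi (Xformula sigma A0 A1 G Psi dPsi).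
  exact: Xformula_is_solution.
by split=> // X Xs t st; exact: is_solution_unique Xs Xsol t st.
Qed.
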